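(* For every $\mathtt{PDL}$ sequent $\Gamma\Rightarrow\Delta$: if $\Gamma\Rightarrow\Delta$ is valid, then $\Gamma\Rightarrow\Delta$ is cut-free provable in $\mathtt{CGPDL}$ (i.e. it has a $\mathtt{CGPDL}$ proof containing no instance of the Cut rule).
   Context: $\mathtt{PDL}$ formulas/programs over sets $\mathsf{Prop}$, $\mathsf{AtProg}$: $\varphi ::= \bot \mid p \mid (\varphi\to\varphi) \mid [\pi]\varphi$, $\pi ::= \alpha \mid \pi;\pi \mid \pi\cup\pi \mid \pi^{*} \mid \varphi?$. $[\pi]\Gamma=\{[\pi]\varphi:\varphi\in\Gamma\}$. A model $M=(W,(R_\alpha),V)$: $W\neq\emptyset$, $R_\alpha\subseteq W\times W$, $V:W\to\mathcal P(\mathsf{Prop})$; $R_{\pi_0;\pi_1}$ composition, $R_{\pi_0\cup\pi_1}$ union, $R_{\pi^*}$ reflexive–transitive closure of $R_\pi$, $R_{\psi?}=\{(w,w):M,w\models\psi\}$; $\bot$ false, $p$ true at $w$ iff $p\in V(w)$, $\to$ classical, $[\pi]\varphi$ true at $w$ iff $\varphi$ true at all $v$ with $wR_\pi v$. A sequent $\Gamma\Rightarrow\Delta$ is a pair of finite sets of formulas; valid if in every model at every state where all of $\Gamma$ hold some formula of $\Delta$ holds. $\mathtt{CGPDL}$ rules (premises / conclusion): (Ax) / $\Gamma\Rightarrow\Delta$, $\Gamma\cap\Delta\neq\emptyset$; ($\bot$) / $\Gamma,\bot\Rightarrow\Delta$; ($\to$L) $\Gamma\Rightarrow\varphi,\Delta$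 and $\Gamma,\psi\Rightarrow\Delta$ / $\Gamma,\varphi\to\psi\Rightarrow\Delta$; ($\to$R) $\Gamma,\varphi\Rightarrow\psi,\Delta$ / $\Gamma\Rightarrow\varphi\to\psi,\Delta$; (Wk) $\Gamma\Rightarrow\Delta$ / $\Gamma'\Rightarrow\Delta'$, $\Gamma\subseteq\Gamma'$, $\Delta\subseteq\Delta'$; (Cut) $\Gamma\Rightarrow\varphi,\Delta$ and $\Gamma,\varphi\Rightarrow\Delta$ / $\Gamma\Rightarrow\Delta$; (K) $\Gamma\Rightarrow\varphi$ / $\Gamma',[\pi]\Gamma\Rightarrow[\pi]\varphi,\Delta$; ($[;]$L) $\Gamma,[\pi_0][\pi_1]\varphi\Rightarrow\Delta$ / $\Gamma,[\pi_0;\pi_1]\varphi\Rightarrow\Delta$; ($[;]$R) $\Gamma\Rightarrow[\pi_0][\pi_1]\varphi,\Delta$ / $\Gamma\Rightarrow[\pi_0;\pi_1]\varphi,\Delta$; ($[\cup]$L) $\Gamma,[\pi_0]\varphi,[\pi_1]\varphi\Rightarrow\Delta$ / $\Gamma,[\pi_0\cup\pi_1]\varphi\Rightarrow\Delta$; ($[\cup]$R) $\Gamma\Rightarrow\Delta,[\pi_0]\varphi$ and $\Gamma\Rightarrow\Delta,[\pi_1]\varphi$ / $\Gamma\Rightarrow[\pi_0\cup\pi_1]\varphi,\Delta$; ($[*]$L) $\Gamma,\varphi,[\pi][\pi^*]\varphi\Rightarrow\Delta$ / $\Gamma,[\pi^*]\varphi\Rightarrow\Delta$; ($[?]$L) $\Gamma\Rightarrow\varphi,\Delta$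 and $\Gamma,\psi\Rightarrow\Delta$ / $\Gamma,[\varphi?]\psi\Rightarrow\Delta$; ($[?]$R) $\Gamma,\varphi\Rightarrow\psi,\Delta$ / $\Gamma\Rightarrow[\varphi?]\psi,\Delta$; (C-s) $\Gamma\Rightarrow\varphi,\Delta$ and $\Gamma\Rightarrow[\pi][\pi^*]\varphi,\Delta$ / $\Gamma\Rightarrow[\pi^*]\varphi,\Delta$. A pre-proof is a finite tree of sequents built of rule instances whose leaves are Ax/$\bot$ instances or buds, with each bud assigned a companion (an inner node labelled with the same sequent); the derivation graph identifies each bud with its companion; a path is a sequence of nodes each a premise of the previous one's rule instance. A trace along a path $(\Gamma_i\Rightarrow\Delta_i)$ is a sequence $\tau_i\in\Delta_i$ such that: at ($\to$R), ($[;]$R), ($[\cup]$R), ($[?]$R), (C-s), either $\tau_{i+1}=\tau_i$ or $\tau_i$ is the principal formula and $\tau_{i+1}$ is its component in the chosen premise ($\psi$ for $\varphi\to\psi$; $[\pi_0][\pi_1]\varphi$ for $[\pi_0;\pi_1]\varphi$; $[\pi_j]\varphi$ for $[\pi_0\cup\pi_1]\varphi$ in the premise containing $[\pi_j]\varphi$; $\psi$ for $[\varphi?]\psi$; $\varphi$ or $[\pi][\pi^*]\varphi$ for $[\pi^*]\varphi$, the latter being a progress point); at (K), $\tau_i$ is the principal formula $[\pi]\varphi$ and $\tau_{i+1}=\varphi$; at all other rules, $\tau_{i+1}=\tau_i$. A $\mathtt{CGPDL}$ proof is a pre-proof in which every infinite path of the derivation graph has a tail followed by a trace with infinitely many progress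 points. *)

(* Defs.v *)
From Stdlib Require Import List Relations.
Import ListNotations.

Set Implicit Arguments.

Section PDL.
Context {P A : Type}.

Inductive form : Type :=
| Bot : form
| Var : P -> form
| Imp : form -> form -> form
| Box : prog -> form -> form
with prog : Type :=
| Atom : A -> prog
| Seq : prog -> prog -> prog
| Cho : prog -> prog -> prog
| Star : prog -> prog
| Test : form -> prog.

Record model : Type := {
  W : Type;
  W_inhabited : inhabited W;
  Rel : A -> W -> W -> Prop;
  Val : W -> P -> Prop
}.

Fixpoint sat (M : model) (w : W M) (f : form) {struct f} : Prop :=
  match f with
  | Bot => False
  | Var p => Val M w p
  | Imp a b => sat M w a -> sat M w b
  | Box pi a => forall v, rel M pi w v -> sat M v a
  end
with rel (M : model) (pi : prog) {struct pi} : W M -> W M -> Prop :=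
  match pi with
  | Atom a => Rel M a
  | Seq x y => fun u v => exists z, rel M x u z /\ rel M y z v
  | Cho x y => fun u v => rel M x u v \/ rel M y u v
  | Star x => clos_refl_trans (W M) (rel M x)
  | Test a => fun u v => u = v /\ sat M u a
  end.

(** * Sequents: pairs of finite sets, represented by lists up to set equality *)
Record sequent : Type := mkSeq { ant : list form; suc : list form }.

Definition seteq (l l' : list form) : Prop := forall x, In x l <-> In x l'.
Definition seq_eq (s t : sequent) : Prop :=
  seteq (ant s) (ant t) /\ seteq (suc s) (suc t).
Definition seqs_eq (ps qs : list sequent) : Prop := Forall2 seq_eq ps qs.

Definition valid (G D : list form) : Prop :=
  forall (M : model) (w : W M),
    (forall f, In f G -> sat M w f) -> exists g, In g D /\ sat M w g.

Inductive rule : Type :=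
| RAx | RBot
| RImpL (f g : form) | RImpR (f g : form)
| RWk | RCut (f : form)
| RK (pi : prog) (f : form)
| RSeqL (p0 p1 : prog) (f : form) | RSeqR (p0 p1 : prog) (f : form)
| RChoL (p0 p1 : prog) (f : form) | RChoR (p0 p1 : prog) (f : form)
| RStarL (pi : prog) (f : form)
| RTestL (f g : form) | RTestR (f g : form)
| RCs (pi : prog) (f : form).

(** [rule_ok r c ps]: r has an instance with conclusion c and premises ps
    (in this order). "G, f" is read as the set G ∪ {f}. *)
Definition rule_ok (r : rule) (c : sequent) (ps : list sequent) : Prop :=
  match r with
  | RAx => ps = [] /\ exists f, In f (ant c) /\ In f (suc c)
  | RBot => ps = [] /\ In Bot (ant c)
  | RImpL f g => exists G D, seq_eq c (mkSeq (Imp f g :: G) D) /\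
      seqs_eq ps [mkSeq G (f :: D); mkSeq (g :: G) D]
  | RImpR f g => exists G D, seq_eq c (mkSeq G (Imp f g :: D)) /\
      seqs_eq ps [mkSeq (f :: G) (g :: D)]
  | RWk => exists p, ps = [p] /\ incl (ant p) (ant c) /\ incl (suc p) (suc c)
  | RCut f => exists G D, seq_eq c (mkSeq G D) /\
      seqs_eq ps [mkSeq G (f :: D); mkSeq (f :: G) D]
  | RK pi f => exists G G' D,
      seq_eq c (mkSeq (G' ++ map (Box pi) G) (Box pi f :: D)) /\
      seqs_eq ps [mkSeq G [f]]
  | RSeqL p0 p1 f => exists G D, seq_eq c (mkSeq (Box (Seq p0 p1) f :: G) D) /\
      seqs_eq ps [mkSeq (Box p0 (Box p1 f) :: G) D]
  | RSeqR p0 p1 f => exists G D, seq_eq c (mkSeq G (Box (Seq p0 p1) f :: D)) /\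
      seqs_eq ps [mkSeq G (Box p0 (Box p1 f) :: D)]
  | RChoL p0 p1 f => exists G D, seq_eq c (mkSeq (Box (Cho p0 p1) f :: G) D) /\
      seqs_eq ps [mkSeq (Box p0 f :: Box p1 f :: G) D]
  | RChoR p0 p1 f => exists G D, seq_eq c (mkSeq G (Box (Cho p0 p1) f :: D)) /\
      seqs_eq ps [mkSeq G (Box p0 f :: D); mkSeq G (Box p1 f :: D)]
  | RStarL pi f => exists G D, seq_eq c (mkSeq (Box (Star pi) f :: G) D) /\
      seqs_eq ps [mkSeq (f :: Box pi (Box (Star pi) f) :: G) D]
  | RTestL f g => exists G D, seq_eq c (mkSeq (Box (Test f) g :: G) D) /\
      seqs_eq ps [mkSeq G (f :: D); mkSeq (g :: G) D]
  | RTestR f g => exists G D, seq_eq c (mkSeq G (Box (Test f) g :: D)) /\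
      seqs_eq ps [mkSeq (f :: G) (g :: D)]
  | RCs pi f => exists G D, seq_eq c (mkSeq G (Box (Star pi) f :: D)) /\
      seqs_eq ps [mkSeq G (f :: D); mkSeq G (Box pi (Box (Star pi) f) :: D)]
  end.

(** Trace condition for one step from the conclusion of [r] to its
    premise number [i] (0-based); membership conditions are added below. *)
Definition tstep (r : rule) (i : nat) (t t' : form) : Prop :=
  match r with
  | RImpR f g => t' = t \/ (t = Imp f g /\ t' = g)
  | RSeqR p0 p1 f => t' = t \/ (t = Box (Seq p0 p1) f /\ t' = Box p0 (Box p1 f))
  | RChoR p0 p1 f => t' = t \/
      (t = Box (Cho p0 p1) f /\ ((i = 0 /\ t' = Box p0 f) \/ (i = 1 /\ t' = Box p1 f)))
  | RTestR f g => t' = t \/ (t = Box (Test f) g /\ t' = g)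
  | RCs pi f => t' = t \/
      (t = Box (Star pi) f /\
       ((i = 0 /\ t' = f) \/ (i = 1 /\ t' = Box pi (Box (Star pi) f))))
  | RK pi f => t = Box pi f /\ t' = f
  | _ => t' = t
  end.

Definition progress (r : rule) (i : nat) (t t' : form) : Prop :=
  match r with
  | RCs pi f => i = 1 /\ t = Box (Star pi) f /\ t' = Box pi (Box (Star pi) f)
  | _ => False
  end.

(** * Pre-proofs: finite trees of rule instances; buds carry the address
    (path of premise indices from the root) of their companion. *)
Inductive ptree : Type :=
| PNode : sequent -> rule -> list ptree -> ptree
| PBud : sequent -> list nat -> ptree.

Definition root_seq (t : ptree) : sequent :=
  match t with PNode s _ _ => s | PBud s _ => s end.

Fixpoint subtree (t : ptree) (a : list nat) {struct a} : option ptree :=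
  match a with
  | [] => Some t
  | i :: a' =>
      match t with
      | PNode _ _ kids =>
          match nth_error kids i with Some k => subtree k a' | None => None end
      | PBud _ _ => None
      end
  end.

Definition preproof (t : ptree) : Prop :=
  (forall a s r kids, subtree t a = Some (PNode s r kids) ->
     rule_ok r s (map root_seq kids)) /\
  (forall a s c, subtree t a = Some (PBud s c) ->
     exists s' r kids, subtree t c = Some (PNode s' r kids) /\ seq_eq s s').

(** Derivation graph: nodes are addresses of inner nodes; edge [a -i-> b]
    to the i-th premise, a bud being identified with its companion. *)
Definition edge (t : ptree) (a : list nat) (i : nat) (b : list nat) : Prop :=
  exists s r kids k, subtree t a = Some (PNode s r kids) /\
    nth_error kids i = Some k /\
    match k with
    | PNode _ _ _ => b = a ++ [i]
    | PBud _ c => b = c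
    end.

Definition trace_ok (t : ptree) (a : list nat) (i : nat) (f f' : form) : Prop :=
  exists s r kids, subtree t a = Some (PNode s r kids) /\
    In f (suc s) /\ tstep r i f f'.

Definition progress_ok (t : ptree) (a : list nat) (i : nat) (f f' : form) : Prop :=
  exists s r kids, subtree t a = Some (PNode s r kids) /\ progress r i f f'.

Definition global_trace_condition (t : ptree) : Prop :=
  forall (p : nat -> list nat) (ix : nat -> nat),
    (forall n, edge t (p n) (ix n) (p (S n))) ->
    exists (N : nat) (tau : nat -> form),
      (forall n, N <= n -> trace_ok t (p n) (ix n) (tau n) (tau (S n))) /\
      (forall m, exists n, m <= n /\ N <= n /\
         progress_ok t (p n) (ix n) (tau n) (tau (S n))).

Definition CGPDL_proof (t : ptree) : Prop :=
  preproof t /\ global_trace_condition t.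

Definition is_cut (r : rule) : Prop :=
  match r with RCut _ => True | _ => False end.

Definition cut_free (t : ptree) : Prop :=
  forall a s r kids, subtree t a = Some (PNode s r kids) -> ~ is_cut r.

Definition cf_provable (G D : list form) : Prop :=
  exists t, CGPDL_proof t /\ cut_free t /\ seq_eq (root_seq t) (mkSeq G D).

End PDL.

Arguments form : clear implicits.
Arguments prog : clear implicits.

(* Main.v *)
Require Import Defs.
From Stdlib Require Import List Lia Arith Relations Classical ClassicalEpsilon.
Import ListNotations.

(** Proof search is made deterministic except for the choice of the K rule.
    Between two K steps the succedent formulas are decomposed one at a time down
    to atoms and boxes [[a]g], and the antecedent is saturated.  A trace step that
    moves either shrinks the formula or is a progress point, so a decomposition
    that never ends is itself a progressing trace.  Call a K step good if its
    principal formula is the end of the trace started by the previous K step;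
    the prover wins a play in which, from some point on, all K steps are good.
    This gives a nested fixed point (least outside, greatest inside) over the
    finitely many configurations built from the Fischer-Ladner closure.  Where
    the prover wins, the stages of the outer fixed point yield a positional
    strategy, whose finite graph unfolds to a cyclic cut-free proof.  Where the
    prover does not win, every trace issued from a K step can be made to end
    inside saturated losing configurations; these form a canonical countermodel,
    and the termination of traces is what refutes [[p*]f] there. *)

(** * Classical decisions and descent on natural numbers *)

Definition dec (Q : Prop) : bool :=
  if excluded_middle_informative Q then true else false.

Lemma dec_spec (Q : Prop) : dec Q = true <-> Q.
Proof. unfold dec; destruct (excluded_middle_informative Q); split; easy. Qed.

Lemma dec_false (Q : Prop) : dec Q = false <-> ~ Q.
Proof. unfold dec; destruct (excluded_middle_informative Q); split; easy. Qed.

(** Strong induction on the value [f N]: a later strict drop restarts the argument from a smaller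
    value, and without one [f] is already constant. *)
Lemma eventually_constant (f : nat -> nat) (N : nat) :
  (forall n, N <= n -> f (S n) <= f n) ->
  exists N', N <= N' /\ forall n, N' <= n -> f (S n) = f n.
Proof.
  remember (f N) as v eqn:E. revert N E.
  induction v as [v IH] using lt_wf_ind; intros N E H.
  destruct (classic (exists n, N <= n /\ f (S n) <> f n)) as [(n & Hn & Hd)|Hno].
  - assert (Hle : forall k, f (N + k) <= f N).
    { induction k; [now rewrite Nat.add_0_r|].
      rewrite Nat.add_succ_r. specialize (H (N + k)); lia. }
    specialize (Hle (n - N)). replace (N + (n - N)) with n in Hle by lia.
    specialize (H n Hn) as H1.
    destruct (IH (f (S n)) ltac:(lia) (S n) eq_refl) as (N' & HN & HC).
    + intros; apply H; lia.
    + exists N'; split; [lia|assumption].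
  - exists N; split; [lia|]. intros n Hn. apply NNPP. eauto.
Qed.

Lemma least_nat (Q : nat -> Prop) :
  (exists n, Q n) -> exists n, Q n /\ forall m, Q m -> n <= m.
Proof.
  intros [n Hn]. induction n as [n IH] using lt_wf_ind.
  destruct (classic (exists m, m < n /\ Q m)) as [(m & Hm & Qm)|Hno]; [eauto|].
  exists n; split; [assumption|]. intros m Qm.
  destruct (le_lt_dec n m); [assumption|]. exfalso; eauto.
Qed.

(** * Finite enumerations of sublists and bounded words *)

Section Sublists.
Context {T : Type}.

Fixpoint sublists (l : list T) : list (list T) :=
  match l with
  | [] => [[]]
  | x :: l' => sublists l' ++ map (cons x) (sublists l')
  end.

Lemma filter_sublists (b : T -> bool) (l : list T) : In (filter b l) (sublists l).
Proof.
  induction l as [|x l IH]; simpl; [now left|].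
  apply in_app_iff. destruct (b x); [right; now apply in_map|now left].
Qed.

Lemma nil_sublists (l : list T) : In [] (sublists l).
Proof. induction l; simpl; [now left|]. apply in_app_iff; now left. Qed.

Lemma sublists_incl (l k : list T) : In k (sublists l) -> incl k l.
Proof.
  revert k; induction l as [|x l IH]; simpl; intros k.
  - intros [<-|[]]; easy.
  - rewrite in_app_iff, in_map_iff. intros [H|(k' & <- & H)].
    + now apply incl_tl, IH.
    + apply incl_cons; [now left|now apply incl_tl, IH].
Qed.

Fixpoint words (n : nat) (l : list T) : list (list T) :=
  match n with
  | 0 => [[]]
  | S n' => [] :: flat_map (fun x => map (cons x) (words n' l)) l
  end.

Lemma words_spec (l : list T) (n : nat) (k : list T) :
  incl k l -> length k <= n -> In k (words n l).
Proof.
  revert k; induction n as [|n IH]; intros [|x k] Hi Hl; simpl in *; try (now left); try lia.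
  right. apply in_flat_map. exists x; split; [apply Hi; now left|].
  apply in_map, IH; [|lia]. intros y Hy; apply Hi; now right.
Qed.

(* The canonical copy of [a ++ k] as a sublist of [l]; canonicity makes the
   number of possible values finite. *)
Definition union (l a k : list T) : list T := filter (fun x => dec (In x a \/ In x k)) l.

Lemma union_sublists (l a k : list T) : In (union l a k) (sublists l).
Proof. apply filter_sublists. Qed.

Lemma in_union (l a k : list T) (x : T) :
  incl a l -> incl k l -> In x (union l a k) <-> In x a \/ In x k.
Proof.
  intros Ha Hk; unfold union. rewrite filter_In, dec_spec. split; [tauto|].
  intros H; split; [|assumption]. destruct H; auto.
Qed.

End Sublists.

(** * Unfolding a finite graph of rule instances into a cyclic proof *)

Section Unfolding.
Context {P A : Type} {St : Type}.
Variables (lab : St -> @sequent P A) (rl : St -> @rule P A) (ch : St -> list St).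
Variables (good : St -> Prop) (all : list St) (s0 : St).
Hypothesis good_s0 : good s0.
Hypothesis good_all : forall s, good s -> In s all.
Hypothesis good_ch : forall s s', good s -> In s' (ch s) -> good s'.
Hypothesis rule_ch : forall s, good s -> rule_ok (rl s) (lab s) (map lab (ch s)).
Hypothesis nocut : forall s, good s -> ~ is_cut (rl s).
Hypothesis traces : forall (q : nat -> St) (ix : nat -> nat),
  (forall n, good (q n)) ->
  (forall n, nth_error (ch (q n)) (ix n) = Some (q (S n))) ->
  exists (N : nat) (tau : nat -> form P A),
    (forall n, N <= n -> In (tau n) (suc (lab (q n))) /\
       tstep (rl (q n)) (ix n) (tau n) (tau (S n))) /\
    (forall m, exists n, m <= n /\ N <= n /\
       progress (rl (q n)) (ix n) (tau n) (tau (S n))).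

(** The default [s] in [nth] makes [run] total: an index out of range stays put, so [run] never
    leaves the good states. *)
Fixpoint run (s : St) (a : list nat) : St :=
  match a with
  | [] => s
  | i :: a' => run (nth i (ch s) s) a'
  end.

Lemma run_app (s : St) (a b : list nat) : run s (a ++ b) = run (run s a) b.
Proof. revert s; induction a; simpl; auto. Qed.

Lemma run_good (s : St) (a : list nat) : good s -> good (run s a).
Proof.
  revert s; induction a as [|i a IH]; simpl; intros s H; [assumption|].
  apply IH. destruct (nth_in_or_default i (ch s) s) as [Hin| ->]; eauto.
Qed.

Definition repeats (a : list nat) (j : nat) : bool := dec (run s0 (firstn j a) = run s0 a).

(* The bud at address [a] points to the first proper prefix of [a] at which the
   same state was visited. *)
Fixpoint build (n : nat) (a : list nat) : ptree :=
  match find (repeats a) (seq 0 (length a)) with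
  | Some j => PBud (lab (run s0 a)) (firstn j a)
  | None =>
      match n with
      | 0 => PBud (lab (run s0 a)) []
      | S n' => PNode (lab (run s0 a)) (rl (run s0 a))
                  (map (fun i => build n' (a ++ [i])) (seq 0 (length (ch (run s0 a)))))
      end
  end.

Lemma root_build (n : nat) (a : list nat) : root_seq (build n a) = lab (run s0 a).
Proof. destruct n; simpl; destruct (find _ _); reflexivity. Qed.

Lemma build_node (n : nat) (a : list nat) s r kids :
  build n a = PNode s r kids ->
  exists n', n = S n' /\ find (repeats a) (seq 0 (length a)) = None /\
    s = lab (run s0 a) /\ r = rl (run s0 a) /\
    kids = map (fun i => build n' (a ++ [i])) (seq 0 (length (ch (run s0 a)))).
Proof.
  destruct n as [|n]; simpl; destruct (find _ _); try discriminate.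
  injection 1 as <- <- <-. eauto 10.
Qed.

Lemma nth_error_map_seq {X : Type} (f : nat -> X) m i k :
  nth_error (map f (seq 0 m)) i = Some k <-> i < m /\ k = f i.
Proof.
  rewrite nth_error_map. destruct (le_lt_dec m i) as [H|H].
  - rewrite (proj2 (nth_error_None (seq 0 m) i)) by (rewrite length_seq; lia).
    simpl; split; [discriminate|lia].
  - rewrite (nth_error_nth' _ 0) by (rewrite length_seq; lia).
    rewrite seq_nth by lia. simpl. split; [injection 1 as <-; auto|intros [_ ->]; auto].
Qed.

Lemma subtree_build (a : list nat) : forall n b k,
  subtree (build n b) a = Some k -> length a <= n /\ k = build (n - length a) (b ++ a).
Proof.
  induction a as [|i a IH]; intros n b k H.
  - simpl in H. injection H as <-. rewrite app_nil_r, Nat.sub_0_r. simpl; split; [lia|easy].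
  - simpl in H. destruct (build n b) as [s r kids|] eqn:E; [|discriminate].
    destruct (build_node _ _ _ _ _ E) as (n' & -> & _ & _ & _ & ->).
    destruct (nth_error _ i) as [k'|] eqn:Ek; [|discriminate].
    apply nth_error_map_seq in Ek as [_ ->].
    apply IH in H as [Hl ->]. rewrite <- app_assoc. simpl; split; [lia|easy].
Qed.

Lemma subtree_app (a b : list nat) : forall t : @ptree P A,
  subtree t (a ++ b) = match subtree t a with Some k => subtree k b | None => None end.
Proof.
  induction a as [|i a IH]; intros t; simpl; [reflexivity|].
  destruct t; [|reflexivity]. destruct (nth_error _ i); auto.
Qed.

Lemma proper_prefix_node (t : @ptree P A) (a : list nat) (j : nat) k :
  subtree t a = Some k -> j < length a ->
  exists s r kids, subtree t (firstn j a) = Some (PNode s r kids).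
Proof.
  intros H Hj. rewrite <- (firstn_skipn j a), subtree_app in H.
  destruct (subtree t (firstn j a)) as [[s r kids|s c]|]; [eauto| |discriminate].
  destruct (skipn j a) eqn:E; [|discriminate].
  apply (f_equal (@length nat)) in E. rewrite length_skipn in E. simpl in E; lia.
Qed.

Let t0 := build (length all) [].

(** A proper prefix of an existing address is an inner node, and [build] makes an inner node only
    after finding no earlier visit to the same state. *)
Lemma prefix_fresh (a : list nat) j k i :
  subtree t0 a = Some k -> j < length a -> i < j ->
  run s0 (firstn i a) <> run s0 (firstn j a).
Proof.
  intros H Hj Hi E. destruct (proper_prefix_node _ _ _ _ H Hj) as (s & r & kids & Hs).
  unfold t0 in Hs. apply subtree_build in Hs as [_ Hs]. symmetry in Hs.
  apply build_node in Hs as (_ & _ & Hf & _). simpl in Hf.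
  apply find_none with (x := i) in Hf.
  - unfold repeats in Hf. rewrite dec_false, firstn_firstn, Nat.min_l in Hf by lia. auto.
  - apply in_seq. rewrite length_firstn. lia.
Qed.

Lemma nodup_prefixes (a : list nat) (m : nat) :
  (forall i j, i < j -> j < m -> run s0 (firstn i a) <> run s0 (firstn j a)) ->
  NoDup (map (fun j => run s0 (firstn j a)) (seq 0 m)).
Proof.
  induction m as [|m IH]; intros H; [constructor|].
  rewrite seq_S, map_app. simpl.
  apply NoDup_app.
  - apply IH; intros; apply H; lia.
  - constructor; [easy|constructor].
  - intros x Hx [<-|[]]. apply in_map_iff in Hx as (i & E & Hi).
    apply in_seq in Hi. revert E. apply H; lia.
Qed.

(** The case to exclude is a placeholder bud left by exhausted fuel: its branch would carry
    [S (length all)] pairwise distinct good states, too many for [all]. *)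
Lemma bud_companion (a : list nat) s c :
  subtree t0 a = Some (PBud s c) ->
  s = lab (run s0 a) /\ run s0 c = run s0 a /\
  exists s' r kids, subtree t0 c = Some (PNode s' r kids).
Proof.
  intros H. pose proof H as H'. unfold t0 in H'. apply subtree_build in H' as [Hl E].
  simpl in E. remember (length all - length a) as m eqn:Em.
  assert (Hfind : forall j, find (repeats a) (seq 0 (length a)) = Some j ->
     j < length a /\ run s0 (firstn j a) = run s0 a).
  { intros j Hf. apply find_some in Hf as [Hin Hr].
    apply in_seq in Hin. unfold repeats in Hr. rewrite dec_spec in Hr. split; [lia|auto]. }
  destruct m as [|m]; simpl in E; destruct (find _ _) as [j|] eqn:Ef; try discriminate;
    try (injection E as -> ->; destruct (Hfind j eq_refl) as [Hj Hr];
         split; [reflexivity|split; [assumption|now apply proper_prefix_node with (PBud (lab (run s0 a)) (firstn j a))]]).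
  exfalso.
  assert (HN : NoDup (map (fun j => run s0 (firstn j a)) (seq 0 (S (length a))))).
  { apply nodup_prefixes. intros i j Hij Hj.
    destruct (Nat.eq_dec j (length a)) as [->|Hne].
    - rewrite firstn_all. apply find_none with (x := i) in Ef.
      + unfold repeats in Ef. now rewrite dec_false in Ef.
      + apply in_seq; lia.
    - eapply prefix_fresh; [exact H|lia|lia]. }
  apply NoDup_incl_length with (l' := all) in HN.
  - rewrite length_map, length_seq in HN. lia.
  - intros x Hx. apply in_map_iff in Hx as (i & <- & _). apply good_all, run_good, good_s0.
Qed.

Lemma inner_node (a : list nat) s r kids :
  subtree t0 a = Some (PNode s r kids) ->
  s = lab (run s0 a) /\ r = rl (run s0 a) /\
  map root_seq kids = map lab (ch (run s0 a)) /\
  forall i k, nth_error kids i = Some k ->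
    nth_error (ch (run s0 a)) i = Some (run s0 (a ++ [i])).
Proof.
  intros H. unfold t0 in H. apply subtree_build in H as [Hl E]. symmetry in E.
  apply build_node in E as (n' & _ & _ & -> & -> & ->). simpl.
  set (c := run s0 a).
  assert (Hn : forall i, i < length (ch c) -> nth_error (ch c) i = Some (run s0 (a ++ [i]))).
  { intros i Hi. rewrite run_app. simpl. now apply nth_error_nth'. }
  repeat split.
  - rewrite map_map. apply nth_error_ext. intros i.
    destruct (le_lt_dec (length (ch c)) i) as [Hi|Hi].
    + rewrite !(proj2 (nth_error_None _ i)); rewrite ?length_map, ?length_seq; auto.
    + rewrite nth_error_map with (l := ch c), Hn by assumption. simpl.
      apply nth_error_map_seq. split; [assumption|]. now rewrite root_build.
  - intros i k Hk. apply nth_error_map_seq in Hk as [Hi _]. auto.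
Qed.

Theorem unfold_graph (G D : list (form P A)) :
  seq_eq (lab s0) (mkSeq G D) -> cf_provable G D.
Proof.
  intros Hlab. exists t0. split; [split; [split|]|split].
  - intros a s r kids H. apply inner_node in H as (-> & -> & -> & _).
    apply rule_ch, run_good, good_s0.
  - intros a s c H. apply bud_companion in H as (-> & E & s' & r & kids & Hc).
    exists s', r, kids. split; [assumption|].
    apply inner_node in Hc as (-> & _). rewrite E. split; intros x; tauto.
  - intros p ix Hp.
    (* A bud and its companion carry the same state, so a path of addresses projects to a path of
       states, to which [traces] applies. *)
    destruct (traces (fun n => run s0 (p n)) ix) as (N & tau & Ht & Hprog).
    + intros n; apply run_good, good_s0.
    + intros n. destruct (Hp n) as (s & r & kids & k & Hs & Hk & Hb).
      pose proof (inner_node _ _ _ _ Hs) as (_ & _ & _ & Hkid).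
      rewrite (Hkid _ _ Hk). f_equal. destruct k as [s' r' kids'|s' c].
      * now rewrite Hb.
      * rewrite Hb. symmetry. apply (bud_companion (p n ++ [ix n]) s' c).
        rewrite subtree_app, Hs. simpl. now rewrite Hk.
    + exists N, tau. split.
      * intros n Hn. destruct (Hp n) as (s & r & kids & k & Hs & _).
        exists s, r, kids. split; [assumption|].
        apply inner_node in Hs as (-> & -> & _). auto.
      * intros m. destruct (Hprog m) as (n & Hm & HN & Hpr). exists n. repeat split; auto.
        destruct (Hp n) as (s & r & kids & k & Hs & _).
        exists s, r, kids. split; [assumption|].
        apply inner_node in Hs as (_ & -> & _). auto.
  - intros a s r kids H. apply inner_node in H as (_ & -> & _).
    apply nocut, run_good, good_s0.
  - unfold t0. now rewrite root_build.
Qed.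

End Unfolding.

(** * Formula size, Fischer-Ladner closure and rule decomposition *)

Section Decomposition.
Context {P A : Type}.
Notation form := (form P A).
Notation prog := (prog P A).
Notation rule := (@rule P A).
Notation sequent := (@sequent P A).

Scheme form_mut := Induction for Defs.form Sort Prop
  with prog_mut := Induction for Defs.prog Sort Prop.
Combined Scheme form_prog_ind from form_mut, prog_mut.

(** A box weighs its program plus its body, so splitting [Seq] loses exactly one; among trace steps
    only the second premise of [RCs] makes a formula grow, and that is a progress point. *)
Fixpoint size (f : form) : nat :=
  match f with
  | Bot | Var _ => 1
  | Imp a b => S (size a + size b)
  | Box p a => psize p + size a
  end
with psize (p : prog) : nat :=
  match p with
  | Atom _ => 1
  | Seq p q | Cho p q => S (psize p + psize q)
  | Star p => S (psize p)
  | Test a => S (size a)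
  end.

Lemma psize_pos (p : prog) : 0 < psize p.
Proof. destruct p; simpl; lia. Qed.

Lemma tstep_size (r : rule) (i : nat) (t t' : form) :
  tstep r i t t' -> t' = t \/ size t' < size t \/ progress r i t t'.
Proof.
  destruct r as [| | | | | |p f| | | | | | | |p f]; simpl; try tauto.
  - intros [->|[-> ->]]; [tauto|]. simpl; right; left; lia.
  - intros [-> ->]. pose proof (psize_pos p). simpl; right; left; lia.
  - intros [->|[-> ->]]; [tauto|]. simpl; right; left; lia.
  - intros [->|[-> [[_ ->]|[_ ->]]]]; [tauto| |]; simpl; right; left; lia.
  - intros [->|[-> ->]]; [tauto|]. simpl; right; left; lia.
  - intros [->|[-> [[_ ->]|[-> ->]]]]; [tauto| |]; simpl; right; [left; lia|tauto].
Qed.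

(* Every non-stuttering step either shrinks the formula or is a progress point,
   so a trace that moves infinitely often progresses infinitely often. *)
Lemma moving_trace_progresses (r : nat -> rule) (ix : nat -> nat) (tau : nat -> form) (N : nat) :
  (forall n, N <= n -> tstep (r n) (ix n) (tau n) (tau (S n))) ->
  (forall m, exists n, m <= n /\ N <= n /\
     (size (tau (S n)) < size (tau n) \/ progress (r n) (ix n) (tau n) (tau (S n)))) ->
  forall m, exists n, m <= n /\ N <= n /\ progress (r n) (ix n) (tau n) (tau (S n)).
Proof.
  intros Ht Hm m. apply NNPP. intros Hno.
  destruct (eventually_constant (fun n => size (tau n)) (max m N)) as (N' & HN & HC).
  - intros n Hn. destruct (tstep_size _ _ _ _ (Ht n ltac:(lia))) as [->|[H|H]]; [lia|lia|].
    exfalso. apply Hno. exists n. repeat split; auto; lia.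
  - destruct (Hm N') as (n & H1 & H2 & [H|H]).
    + specialize (HC n H1). simpl in HC. lia.
    + apply Hno. exists n. repeat split; auto; lia.
Qed.

(** Everything that decomposing [f], on either side or by K, can introduce; a set closed under it
    confines the whole search. *)
Definition components (f : form) : list form :=
  match f with
  | Bot | Var _ => []
  | Imp a b => [a; b]
  | Box (Atom _) a => [a]
  | Box (Seq p q) a => [Box p (Box q a)]
  | Box (Cho p q) a => [Box p a; Box q a]
  | Box (Star p) a => [a; Box p (Box (Star p) a)]
  | Box (Test a) b => [a; b]
  end.

(* Fischer-Ladner closure; [fl_box p a] omits the closure of [a]. *)
Fixpoint fl (f : form) : list form :=
  match f with
  | Bot => [Bot]
  | Var x => [Var x]
  | Imp a b => Imp a b :: fl a ++ fl b
  | Box p a => fl_box p a ++ fl a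
  end
with fl_box (p : prog) (a : form) : list form :=
  match p with
  | Atom x => [Box (Atom x) a]
  | Seq p q => Box (Seq p q) a :: fl_box p (Box q a) ++ fl_box q a
  | Cho p q => Box (Cho p q) a :: fl_box p a ++ fl_box q a
  | Star p => Box (Star p) a :: fl_box p (Box (Star p) a)
  | Test b => Box (Test b) a :: fl b
  end.

Lemma fl_box_self (p : prog) (a : form) : In (Box p a) (fl_box p a).
Proof. destruct p; simpl; now left. Qed.

Lemma fl_self (f : form) : In f (fl f).
Proof.
  destruct f; simpl; try (now left). apply in_app_iff; left; apply fl_box_self.
Qed.

(** Simultaneous induction on formulas and programs. A component leaves [fl_box p a] only towards
    [a] itself, which the surrounding closure supplies. *)
Lemma fl_closed :
  (forall f g : form, In g (fl f) -> incl (components g) (fl f)) /\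
  (forall (p : prog) a g, In g (fl_box p a) -> incl (components g) (a :: fl_box p a)).
Proof.
  apply form_prog_ind.
  - intros g [<-|[]]; easy.
  - intros x g [<-|[]]; easy.
  - intros a IHa b IHb g. simpl. rewrite in_app_iff.
    intros [<-|[H|H]] h Hh; simpl; rewrite in_app_iff.
    + destruct Hh as [<-|[<-|[]]]; auto using fl_self.
    + right; left; eapply IHa; eauto.
    + right; right; eapply IHb; eauto.
  - intros p IHp a IHa g. simpl. rewrite in_app_iff.
    intros [H|H] h Hh; rewrite in_app_iff.
    + destruct (IHp a g H h Hh) as [<-|Hin]; auto using fl_self.
    + right; eapply IHa; eauto.
  - intros x a g [<-|[]] h [<-|[]]; now left.
  - intros p IHp q IHq a g. simpl. rewrite in_app_iff.
    intros [<-|[H|H]] h Hh; simpl; rewrite in_app_iff.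
    + destruct Hh as [<-|[]]; auto using fl_box_self.
    + destruct (IHp _ g H h Hh) as [<-|Hin]; auto using fl_box_self.
    + destruct (IHq _ g H h Hh) as [<-|Hin]; auto using fl_box_self.
  - intros p IHp q IHq a g. simpl. rewrite in_app_iff.
    intros [<-|[H|H]] h Hh; simpl; rewrite in_app_iff.
    + destruct Hh as [<-|[<-|[]]]; auto using fl_box_self.
    + destruct (IHp _ g H h Hh) as [<-|Hin]; auto.
    + destruct (IHq _ g H h Hh) as [<-|Hin]; auto.
  - intros p IHp a g. simpl.
    intros [<-|H] h Hh; simpl.
    + destruct Hh as [<-|[<-|[]]]; auto using fl_box_self.
    + destruct (IHp _ g H h Hh) as [<-|Hin]; auto.
  - intros b IHb a g. simpl.
    intros [<-|H] h Hh; simpl.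
    + destruct Hh as [<-|[<-|[]]]; auto using fl_self.
    + right; right; eapply IHb; eauto.
Qed.

(* [rdec f = Some (r, L, alts)]: the right rule [r] for [f] adds [L] to every
   antecedent and replaces [f] by one element of [alts] in each premise. *)
Definition rdec (f : form) : option (rule * list form * list form) :=
  match f with
  | Bot | Var _ | Box (Atom _) _ => None
  | Imp a b => Some (RImpR a b, [a], [b])
  | Box (Seq p q) a => Some (RSeqR p q a, [], [Box p (Box q a)])
  | Box (Cho p q) a => Some (RChoR p q a, [], [Box p a; Box q a])
  | Box (Star p) a => Some (RCs p a, [], [a; Box p (Box (Star p) a)])
  | Box (Test a) b => Some (RTestR a b, [a], [b])
  end.

(* The left rule for [f] with, for each premise, the formulas added to the
   antecedent and to the succedent; irreducible formulas get a trivial weakening. *)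
Definition ldec (f : form) : rule * list (list form * list form) :=
  match f with
  | Bot | Var _ | Box (Atom _) _ => (RWk, [([], [])])
  | Imp a b => (RImpL a b, [([], [a]); ([b], [])])
  | Box (Seq p q) a => (RSeqL p q a, [([Box p (Box q a)], [])])
  | Box (Cho p q) a => (RChoL p q a, [([Box p a; Box q a], [])])
  | Box (Star p) a => (RStarL p a, [([a; Box p (Box (Star p) a)], [])])
  | Box (Test a) b => (RTestL a b, [([], [a]); ([b], [])])
  end.

Lemma rdec_components f r L alts :
  rdec f = Some (r, L, alts) -> incl L (components f) /\ incl alts (components f).
Proof.
  destruct f as [|x|a b|[x|p q|p q|p|b] a]; simpl; try discriminate;
    injection 1 as <- <- <-; split; intros y; simpl; tauto.
Qed.

Lemma ldec_components f L st :
  In (L, st) (snd (ldec f)) ->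
  incl L (components f) /\ incl st (components f) /\ length st <= 1.
Proof.
  destruct f as [|x|a b|[x|p q|p q|p|b] a]; simpl;
    intros H; repeat (destruct H as [H|H]; [injection H as <- <-|]); try contradiction;
    (split; [|split]); try (intros y; simpl; tauto); simpl; lia.
Qed.

Lemma rdec_rule_ok f r L alts c ps G D :
  rdec f = Some (r, L, alts) -> seq_eq c (mkSeq G (f :: D)) ->
  seqs_eq ps (map (fun g => mkSeq (L ++ G) (g :: D)) alts) -> rule_ok r c ps.
Proof.
  destruct f as [|x|a b|[x|p q|p q|p|b] a]; simpl; try discriminate;
    injection 1 as <- <- <-; simpl; eauto.
Qed.

Lemma ldec_rule_ok f c ps G D :
  seq_eq c (mkSeq (f :: G) D) ->
  seqs_eq ps (map (fun p => mkSeq (fst p ++ G) (snd p ++ D)) (snd (ldec f))) ->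
  rule_ok (fst (ldec f)) c ps.
Proof.
  destruct f as [|x|a b|[x|p q|p q|p|b] a]; simpl; eauto;
    intros [H1 H2] H; inversion H as [|y ? l ? [H3 H4] Hn]; subst; inversion Hn; subst;
    exists y; (split; [reflexivity|]); simpl in *;
    (split; intros z Hz; [apply H1; right; now apply H3|now apply H2, H4]).
Qed.

Lemma rdec_nocut f r L alts : rdec f = Some (r, L, alts) -> ~ is_cut r.
Proof.
  destruct f as [|x|a b|[x|p q|p q|p|b] a]; simpl; try discriminate;
    injection 1 as <- <- <-; simpl; tauto.
Qed.

Lemma ldec_nocut f : ~ is_cut (fst (ldec f)).
Proof. destruct f as [|x|a b|[x|p q|p q|p|b] a]; simpl; tauto. Qed.

Lemma rdec_tstep f r L alts i g :
  rdec f = Some (r, L, alts) -> nth_error alts i = Some g ->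
  tstep r i f g /\ (size g < size f \/ progress r i f g) /\ forall t, tstep r i t t.
Proof.
  destruct f as [|x|a b|[x|p q|p q|p|b] a]; simpl; try discriminate;
    injection 1 as <- <- <-; destruct i as [|[|i]]; simpl; try discriminate;
    try (rewrite nth_error_nil; discriminate); injection 1 as <-;
    (split; [tauto|split; [|tauto]]);
    try (right; tauto); left; simpl; try lia.
Qed.

Lemma ldec_tstep f i t : tstep (fst (ldec f)) i t t.
Proof. destruct f as [|x|a b|[x|p q|p q|p|b] a]; reflexivity. Qed.

Fixpoint tests (p : prog) : list form :=
  match p with
  | Atom _ => []
  | Seq p q | Cho p q => tests p ++ tests q
  | Star p => tests p
  | Test a => [a]
  end.

(* The formulas that decomposing [f] on the right can move to the left. *)
Fixpoint lefts (f : form) : list form :=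
  match f with
  | Bot | Var _ => []
  | Imp a b => a :: lefts b
  | Box p a => tests p ++ lefts a
  end.

Lemma rdec_lefts f r L alts g :
  rdec f = Some (r, L, alts) -> In g alts -> incl L (lefts f) /\ incl (lefts g) (lefts f).
Proof.
  destruct f as [|x|a b|[x|p q|p q|p|b] a]; simpl; try discriminate;
    injection 1 as <- <- <-; simpl; intros H; repeat (destruct H as [<-|H]); try contradiction;
    split; intros y; simpl; rewrite ?in_app_iff; tauto.
Qed.

(** Falsity passes from a premise of a right rule to its conclusion; for a star this uses
    reflexivity at the first premise and one initial step at the second. *)
Lemma rdec_false (M : @model P A) (w : W M) f r L alts g :
  rdec f = Some (r, L, alts) -> (forall h, In h L -> sat M w h) ->
  In g alts -> ~ sat M w g -> ~ sat M w f.
Proof.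
  destruct f as [|x|a b|[x|p q|p q|p|b] a]; simpl; try discriminate;
    injection 1 as <- <- <-; simpl; intros HL H Hg Hf;
    repeat (destruct H as [<-|H]); try contradiction; apply Hg; simpl.
  - apply Hf; auto.
  - intros v Hv u Hu. apply Hf; eauto.
  - intros v Hv. apply Hf; eauto.
  - intros v Hv. apply Hf; eauto.
  - apply Hf, rt_refl.
  - intros v Hv u Hu. apply Hf. eapply rt_trans; [apply rt_step|]; eauto.
  - apply Hf; auto.
Qed.

End Decomposition.

(** * Configurations and local proof search *)

Section Search.
Context {P A : Type}.
Notation form := (form P A).
Notation prog := (prog P A).
Notation rule := (@rule P A).
Notation sequent := (@sequent P A).
Variables (cl : list form) (depth : nat).
Hypothesis cl_closed : forall f, In f cl -> incl (components f) cl.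

(* [stack] holds the succedent formulas still to be decomposed, [cD] the
   irreducible ones already reached, [done] the antecedent formulas already
   treated; [main] is the formula whose trace is being followed. *)
Record config : Type := Config
  { cG : list form; cD : list form; done : list form; main : form; stack : list form }.

Definition label (c : config) : sequent := mkSeq (cG c) (stack c ++ cD c).

Definition follow (g g' m : form) : form := if dec (m = g) then g' else m.

(** Moving an irreducible formula from [stack] to [cD] leaves the sequent unchanged as a set, so an
    instance of [RWk] covers it. *)
Definition right_step (c : config) (g : form) (st : list form) : rule * list config :=
  match rdec g with
  | Some (r, L, alts) =>
      (r, map (fun g' => Config (union cl L (cG c)) (cD c) (done c)
                           (follow g g' (main c)) (g' :: st)) alts)
  | None => (RWk, [Config (cG c) (union cl [g] (cD c)) (done c) (main c) st])
  end.

Definition left_step (c : config) (f : form) : rule * list config :=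
  (fst (ldec f),
   map (fun p => Config (union cl (fst p) (cG c)) (cD c) (union cl [f] (done c))
                   (main c) (snd p)) (snd (ldec f))).

(** Returns [None] at unclosed saturated configurations, where the prover must choose a K step. *)
Definition local_step (c : config) : option (rule * list config) :=
  if dec (exists f, In f (cG c) /\ In f (stack c ++ cD c)) then Some (RAx, [])
  else if dec (In Bot (cG c)) then Some (RBot, [])
  else match stack c with
       | g :: st => Some (right_step c g st)
       | [] => match find (fun f => negb (dec (In f (done c)))) (cG c) with
               | Some f => Some (left_step c f)
               | None => None
               end
       end.

Lemma local_step_some c r cs :
  local_step c = Some (r, cs) ->
  (cs = [] /\ rule_ok r (label c) [] /\ ~ is_cut r) \/
  (exists g st, stack c = g :: st /\ right_step c g st = (r, cs)) \/
  (exists f, stack c = [] /\ In f (cG c) /\ ~ In f (done c) /\ left_step c f = (r, cs)).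
Proof.
  unfold local_step.
  destruct (dec (exists f, _)) eqn:E1.
  { rewrite dec_spec in E1. injection 1 as <- <-. left. simpl. auto. }
  destruct (dec (In Bot _)) eqn:E2.
  { rewrite dec_spec in E2. injection 1 as <- <-. left. simpl. auto. }
  destruct (stack c) as [|g st].
  - destruct (find _ _) as [f|] eqn:Ef; [|discriminate]. intros H.
    assert (Hl : left_step c f = (r, cs)) by congruence.
    apply find_some in Ef as [Hin Hb]. right; right. exists f. repeat split; auto.
    rewrite <- dec_false. now apply Bool.negb_true_iff.
  - intros H. right; left. exists g, st. split; congruence.
Qed.

Lemma local_step_none c :
  local_step c = None ->
  stack c = [] /\ incl (cG c) (done c) /\
  (forall f, In f (cG c) -> ~ In f (cD c)) /\ ~ In Bot (cG c).
Proof.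
  unfold local_step.
  destruct (dec (exists f, _)) eqn:E1; [discriminate|]. rewrite dec_false in E1.
  destruct (dec (In Bot _)) eqn:E2; [discriminate|]. rewrite dec_false in E2.
  destruct (stack c) as [|g st]; [|discriminate].
  destruct (find _ _) as [f|] eqn:Ef; [discriminate|]. intros _.
  repeat split; auto.
  - intros f Hf. apply find_none with (x := f) in Ef; [|assumption].
    rewrite <- dec_spec. now apply Bool.negb_false_iff.
  - intros f Hf Hd. apply E1. eauto.
Qed.

(** The strongest premise that K offers for this principal box. [done] restarts empty, as the new
    antecedent is still untreated. *)
Definition box_step (c : config) (a : A) (g : form) : config :=
  Config (filter (fun x => dec (In (Box (Atom a) x) (cG c))) cl) [] [] g [g].

(** The bound [S depth] leaves room for the single formula pushed by a left or K step even when
    [depth] is 0. The alternative [main c = Bot] is a default for an empty initial succedent. *)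
Definition inv (c : config) : Prop :=
  In (cG c) (sublists cl) /\ In (cD c) (sublists cl) /\ In (done c) (sublists cl) /\
  incl (stack c) cl /\ length (stack c) <= S depth /\
  (forall e, In e (cD c) -> rdec e = None) /\
  (In (main c) (stack c ++ cD c) \/ main c = Bot).

Definition all_configs : list config :=
  map (fun x => let '(G, (D, (Dn, (m, st)))) := x in Config G D Dn m st)
    (list_prod (sublists cl) (list_prod (sublists cl) (list_prod (sublists cl)
       (list_prod (Bot :: cl) (words (S depth) cl))))).

Lemma inv_finite c : inv c -> In c all_configs.
Proof.
  intros (H1 & H2 & H3 & H4 & H5 & _ & H6). unfold all_configs.
  apply in_map_iff. exists (cG c, (cD c, (done c, (main c, stack c)))).
  split; [now destruct c|]. do 3 (apply in_prod; [assumption|]).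
  apply in_prod; [|now apply words_spec].
  destruct H6 as [H6| ->]; [right|now left].
  apply in_app_iff in H6 as [H6|H6]; [now apply H4|].
  now apply (sublists_incl _ _ H2).
Qed.

Lemma inv_union c L :
  inv c -> incl L cl -> forall x, In x (union cl L (cG c)) <-> In x L \/ In x (cG c).
Proof. intros (H & _) HL x. apply in_union; auto using sublists_incl. Qed.

Lemma local_step_inv c r cs c' :
  inv c -> local_step c = Some (r, cs) -> In c' cs -> inv c'.
Proof.
  intros (HG & HD & Hdn & Hst & Hlen & Hend & Hm) Hs Hc'.
  destruct (local_step_some _ _ _ Hs) as [(-> & _)|[(g & st & E & Er)|(f & E & Hf & Hnd & El)]];
    [contradiction| |].
  - rewrite E in *. unfold right_step in Er. apply incl_cons_inv in Hst as [Hg Hst].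
    destruct (rdec g) as [[[r' L] alts]|] eqn:Ed.
    + injection Er as <- <-. apply in_map_iff in Hc' as (g' & <- & Hg').
      destruct (rdec_components _ _ _ _ Ed) as [HL Ha].
      repeat split; simpl; auto using union_sublists.
      * apply incl_cons; [|assumption]. now apply (cl_closed g Hg), Ha.
      * unfold follow. destruct (dec (main c = g)) eqn:Em; [left; now left|].
        rewrite dec_false in Em. destruct Hm as [[Hm|Hm]|Hm]; subst; auto; try congruence.
    + injection Er as <- <-. destruct Hc' as [<-|[]].
      assert (Hu : forall x, In x (union cl [g] (cD c)) <-> In x [g] \/ In x (cD c)).
      { intros x; apply in_union; [|now apply sublists_incl].
        now intros y [<-|[]]. }
      repeat split; simpl in *; auto using union_sublists; try lia.
      * intros e He. apply Hu in He as [[<-|[]]|He]; auto.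
      * destruct Hm as [Hm|Hm]; [left|now right]. rewrite in_app_iff in *. rewrite Hu.
        simpl. tauto.
  - injection El as <- <-. apply in_map_iff in Hc' as ([L st] & <- & Hp).
    destruct (ldec_components _ _ _ Hp) as (HL & Hs' & Hl').
    assert (Hfc : In f cl) by now apply (sublists_incl _ _ HG).
    repeat split; simpl; auto using union_sublists; try lia.
    + intros x Hx. now apply (cl_closed f Hfc), Hs'.
    + rewrite E in Hm. simpl in Hm. rewrite in_app_iff. tauto.
Qed.

Lemma box_step_inv c a g : inv c -> In (Box (Atom a) g) (cD c) -> inv (box_step c a g).
Proof.
  intros (HG & HD & _) Hin.
  assert (Hg : In g cl).
  { apply (cl_closed (Box (Atom a) g)); [|now left]. now apply (sublists_incl _ _ HD). }
  repeat split; simpl; auto using filter_sublists, nil_sublists; try tauto; try lia.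
  now intros x [<-|[]].
Qed.

Lemma box_step_ant c a g x :
  inv c -> In (Box (Atom a) x) (cG c) -> In x (cG (box_step c a g)).
Proof.
  intros (HG & _) Hin. simpl. rewrite filter_In, dec_spec. split; [|assumption].
  apply (cl_closed (Box (Atom a) x)); [|now left]. now apply (sublists_incl _ _ HG).
Qed.

Lemma seqs_eq_map {X : Type} (f g : X -> sequent) (l : list X) :
  (forall x, In x l -> seq_eq (f x) (g x)) -> seqs_eq (map f l) (map g l).
Proof.
  induction l as [|x l IH]; intros H; simpl; constructor; [apply H; now left|].
  apply IH; intros; apply H; now right.
Qed.

Lemma local_step_rule c r cs :
  inv c -> local_step c = Some (r, cs) -> rule_ok r (label c) (map label cs) /\ ~ is_cut r.
Proof.
  intros Hinv Hs. pose proof Hinv as (HG & HD & Hdn & Hst & _).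
  destruct (local_step_some _ _ _ Hs) as [(-> & H)|[(g & st & E & Er)|(f & E & Hf & Hnd & El)]];
    [assumption| |].
  - unfold right_step in Er. rewrite E in Hst. apply incl_cons_inv in Hst as [Hg Hst].
    destruct (rdec g) as [[[r' L] alts]|] eqn:Ed.
    + injection Er as <- <-. split; [|eapply rdec_nocut; eauto].
      destruct (rdec_components _ _ _ _ Ed) as [HL Ha].
      apply rdec_rule_ok with (1 := Ed) (G := cG c) (D := st ++ cD c).
      * unfold label. rewrite E. split; intros x; simpl; tauto.
      * rewrite map_map. apply seqs_eq_map. intros g' Hg'. split; intros x; simpl; [|tauto].
        rewrite inv_union, in_app_iff; [tauto|assumption|].
        intros y Hy. now apply (cl_closed g Hg), HL.
    + injection Er as <- <-. split; [|simpl; tauto]. eexists; split; [reflexivity|].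
      simpl. split; [apply incl_refl|]. rewrite E. intros x. simpl. rewrite !in_app_iff, in_union.
      * simpl; tauto.
      * now intros y [<-|[]].
      * now apply sublists_incl.
  - injection El as <- <-. split; [|apply ldec_nocut].
    assert (Hfc : In f cl) by now apply (sublists_incl _ _ HG).
    apply ldec_rule_ok with (G := cG c) (D := cD c).
    + unfold label. rewrite E. split; intros x; simpl; [|tauto].
      split; [tauto|]. intros [<-|]; auto.
    + rewrite map_map. apply seqs_eq_map. intros [L st] Hp.
      destruct (ldec_components _ _ _ Hp) as (HL & Hs' & Hl').
      split; intros x; simpl; [|tauto].
      rewrite inv_union, in_app_iff; [tauto|assumption|].
      intros y Hy. now apply (cl_closed f Hfc), HL.
Qed.

Lemma box_step_rule c a g :
  In (Box (Atom a) g) (cD c) ->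
  rule_ok (RK (Atom a) g) (label c) (map label [box_step c a g]).
Proof.
  intros Hin. simpl. exists (cG (box_step c a g)), (cG c), (stack c ++ cD c). split.
  2: { constructor; [|constructor]. split; intros x; reflexivity. }
  split; intros x; simpl.
  - rewrite in_app_iff, in_map_iff. split; [tauto|]. intros [H|(y & <- & H)]; [assumption|].
    now rewrite filter_In, dec_spec in H.
  - rewrite in_app_iff. split; [tauto|]. intros [<-|H]; [now right|tauto].
Qed.

(** * Termination measure for local steps *)

Definition missing (c : config) : nat :=
  length (filter (fun x => negb (dec (In x (done c)))) cl).

(** A left step lowers [missing] by at least one and pushes at most one formula, hence the factor
    2. *)
Definition measure (c : config) : nat := 2 * missing c + length (stack c).

Lemma filter_length_le {X : Type} (b b' : X -> bool) (l : list X) :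
  (forall x, b' x = true -> b x = true) -> length (filter b' l) <= length (filter b l).
Proof.
  intros H. induction l as [|x l IH]; simpl; [lia|].
  destruct (b' x) eqn:E'; [rewrite (H x E'); simpl; lia|]. destruct (b x); simpl; lia.
Qed.

Lemma filter_length_lt {X : Type} (b b' : X -> bool) (l : list X) (y : X) :
  (forall x, b' x = true -> b x = true) -> In y l -> b y = true -> b' y = false ->
  length (filter b' l) < length (filter b l).
Proof.
  intros H Hy Hb Hb'. induction l as [|x l IH]; [contradiction|]. simpl.
  destruct Hy as [->|Hy].
  - rewrite Hb, Hb'. pose proof (filter_length_le b b' l H). simpl; lia.
  - specialize (IH Hy). destruct (b' x) eqn:E'; [rewrite (H x E'); simpl; lia|].
    destruct (b x); simpl; lia.
Qed.

Lemma left_step_measure c f st :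
  inv c -> In f (cG c) -> ~ In f (done c) -> stack c = [] -> length st <= 1 ->
  forall G D m, measure (Config G D (union cl [f] (done c)) m st) < measure c.
Proof.
  intros (HG & _ & Hdn & _) Hf Hnd E Hl G D m. unfold measure. rewrite E. simpl.
  assert (Hfc : In f cl) by now apply (sublists_incl _ _ HG).
  assert (Hu : forall x, In x (union cl [f] (done c)) <-> In x [f] \/ In x (done c)).
  { intros x; apply in_union; [now intros y [<-|[]]|now apply sublists_incl]. }
  enough (missing (Config G D (union cl [f] (done c)) m st) < missing c) by lia.
  unfold missing; simpl. apply filter_length_lt with f; auto.
  - intros x. rewrite !Bool.negb_true_iff, !dec_false, Hu. tauto.
  - now rewrite Bool.negb_true_iff, dec_false.
  - rewrite Bool.negb_false_iff, dec_spec, Hu. left; now left.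
Qed.

(* Either the head of the stack moves, or the measure drops. *)
Lemma local_step_trace c r cs i c' :
  inv c -> local_step c = Some (r, cs) -> nth_error cs i = Some c' ->
  tstep r i (main c) (main c') /\
  (In (main c) (suc (label c)) -> In (main c') (suc (label c'))) /\
  (measure c' < measure c \/
   measure c' = measure c /\
   In (hd Bot (stack c)) (suc (label c)) /\
   tstep r i (hd Bot (stack c)) (hd Bot (stack c')) /\
   (size (hd Bot (stack c')) < size (hd Bot (stack c)) \/
    progress r i (hd Bot (stack c)) (hd Bot (stack c')))).
Proof.
  intros Hinv Hs Hi. pose proof Hinv as (HG & HD & Hdn & Hst & _).
  destruct (local_step_some _ _ _ Hs) as [(-> & H)|[(g & st & E & Er)|(f & E & Hf & Hnd & El)]].
  - now rewrite nth_error_nil in Hi.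
  - unfold right_step in Er. rewrite E in *. apply incl_cons_inv in Hst as [Hg Hst].
    destruct (rdec g) as [[[r' L] alts]|] eqn:Ed.
    + injection Er as <- <-. rewrite nth_error_map in Hi.
      destruct (nth_error alts i) as [g'|] eqn:Eg; [|discriminate]. injection Hi as <-.
      destruct (rdec_tstep _ _ _ _ _ _ Ed Eg) as (Ht & Hsz & Hid).
      simpl. rewrite E. simpl. unfold follow. split; [|split].
      * destruct (dec (main c = g)) eqn:Em; [|auto]. rewrite dec_spec in Em. now rewrite Em.
      * destruct (dec (main c = g)) eqn:Em; [now left|]. rewrite dec_false in Em.
        intros [H|H]; [congruence|now right].
      * right. unfold measure, missing. simpl. rewrite E. simpl. auto.
    + injection Er as <- <-. destruct i as [|i]; [|now simpl in Hi; rewrite nth_error_nil in Hi].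
      injection Hi as <-. simpl. rewrite E. simpl. split; [reflexivity|split].
      * rewrite !in_app_iff, in_union; [simpl; tauto|now intros y [<-|[]]|now apply sublists_incl].
      * left. unfold measure, missing. simpl. rewrite E. simpl. lia.
  - injection El as <- <-. rewrite nth_error_map in Hi.
    destruct (nth_error (snd (ldec f)) i) as [[L st]|] eqn:Ep; [|discriminate]. injection Hi as <-.
    apply nth_error_In in Ep. destruct (ldec_components _ _ _ Ep) as (HL & Hs' & Hl').
    simpl. split; [apply ldec_tstep|split].
    + rewrite E. simpl. rewrite in_app_iff. tauto.
    + left. eapply left_step_measure; eauto.
Qed.

(** * The game and its nested fixed point *)

(** Only the K step is a choice of the prover; one that abandons the main trace has to reach the
    outer set [X]. *)
Definition win_step (X Y : config -> Prop) (c : config) : Prop :=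
  match local_step c with
  | Some (_, cs) => forall c', In c' cs -> Y c'
  | None => exists a g, In (Box (Atom a) g) (cD c) /\
      (X (box_step c a g) \/ main c = Box (Atom a) g /\ Y (box_step c a g))
  end.

(* [win (S n)] is the greatest fixed point of [win_step (win n)]: the prover
   can keep the main trace unbroken until some K step leads into [win n]. *)
Fixpoint win (n : nat) : config -> Prop :=
  match n with
  | 0 => fun _ => False
  | S n' => fun c => exists Y : config -> Prop,
      (forall d, Y d -> win_step (win n') Y d) /\ Y c
  end.

Lemma win_step_mono (X X' Y Y' : config -> Prop) c :
  (forall d, X d -> X' d) -> (forall d, Y d -> Y' d) -> win_step X Y c -> win_step X' Y' c.
Proof.
  intros HX HY. unfold win_step. destruct (local_step c) as [[r cs]|]; [auto|].
  intros (a & g & Hin & H). exists a, g. split; [assumption|]. destruct H as [H|[E H]]; auto.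
Qed.

(** Knaster-Tarski: the union of all post-fixed points is again a post-fixed point. *)
Lemma win_unfold n c : win (S n) c -> win_step (win n) (win (S n)) c.
Proof.
  intros (Y & HY & Hc). apply win_step_mono with (win n) Y; auto.
  intros d Hd. exists Y; auto.
Qed.

Lemma win_succ n c : win n c -> win (S n) c.
Proof.
  revert c; induction n as [|n IH]; intros c; [contradiction|].
  intros (Y & HY & Hc). exists Y. split; [|assumption].
  intros d Hd. apply win_step_mono with (win n) Y; auto.
Qed.

Lemma win_mono n m c : n <= m -> win n c -> win m c.
Proof. induction 1; auto using win_succ. Qed.

(** The stages increase and there are finitely many configurations, so a maximum of their entry
    stages bounds them all. *)
Lemma win_bound : exists N, forall c n, inv c -> win n c -> win N c.
Proof.
  assert (H : exists N, forall c, In c all_configs -> forall n, win n c -> win N c).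
  { induction all_configs as [|d l [N IH]]; [now exists 0|].
    destruct (classic (exists n, win n d)) as [[k Hk]|Hno].
    - exists (max k N). intros c [<-|Hc] n Hn.
      + apply win_mono with k; [lia|assumption].
      + apply win_mono with N; [lia|eauto].
    - exists N. intros c [<-|Hc] n Hn; [exfalso|]; eauto. }
  destruct H as [N H]. exists N. eauto using inv_finite.
Qed.

(** * Positional winning strategy and its traces *)

Definition good (c : config) : Prop := inv c /\ exists n, win n c.

(** The first outer stage containing [c]. The strategy never raises it, so along a play it is
    eventually constant. *)
Definition rank (c : config) : nat :=
  epsilon (inhabits 0) (fun n => win n c /\ forall m, win m c -> n <= m).

Lemma rank_spec c : good c -> win (rank c) c /\ forall m, win m c -> rank c <= m.
Proof.
  intros [_ H]. unfold rank. apply epsilon_spec. now apply least_nat.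
Qed.

Definition node (c : config) (x : rule * list config) : Prop :=
  (local_step c = Some x \/
   local_step c = None /\ exists a g, x = (RK (Atom a) g, [box_step c a g]) /\
     In (Box (Atom a) g) (cD c) /\
     (rank (box_step c a g) < rank c \/ main c = Box (Atom a) g)) /\
  forall c', In c' (snd x) -> good c' /\ rank c' <= rank c.

(** Unfold [win] at the least stage: local successors remain in that stage, and a K step that uses
    the outer set enters an earlier one, so its rank strictly drops. *)
Lemma node_exists c : good c -> exists x, node c x.
Proof.
  intros Hg. destruct (rank_spec c Hg) as [Hw _]. pose proof Hg as [Hinv _].
  destruct (rank c) as [|n] eqn:En; [contradiction|].
  apply win_unfold in Hw. unfold win_step in Hw.
  destruct (local_step c) as [[r cs]|] eqn:Es.
  - exists (r, cs). split; [now left|]. simpl. intros c' Hc'.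
    assert (Hg' : good c').
    { split; [eapply local_step_inv; eauto|eauto]. }
    split; [assumption|]. rewrite En. now apply rank_spec; auto.
  - destruct Hw as (a & g & Hin & Hw). exists (RK (Atom a) g, [box_step c a g]).
    assert (Hg' : good (box_step c a g)).
    { split; [now apply box_step_inv|]. destruct Hw as [Hw|[_ Hw]]; eauto. }
    destruct (rank_spec _ Hg') as [_ Hmin]. split.
    + right. split; [assumption|]. exists a, g. repeat split; [assumption|].
      destruct Hw as [Hw|[E _]]; [left|now right]. specialize (Hmin _ Hw). lia.
    + intros c' [<-|[]]. split; [assumption|].
      destruct Hw as [Hw|[_ Hw]]; specialize (Hmin _ Hw); lia.
Qed.

Definition strategy (c : config) : rule * list config :=
  epsilon (inhabits (RAx, [])) (node c).

Lemma strategy_node c : good c -> node c (strategy c).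
Proof. intros H. unfold strategy. now apply epsilon_spec, node_exists. Qed.

Lemma strategy_rule c :
  good c -> rule_ok (fst (strategy c)) (label c) (map label (snd (strategy c))) /\
            ~ is_cut (fst (strategy c)).
Proof.
  intros Hg. destruct (strategy_node c Hg) as [[Hs|(_ & a & g & -> & Hin & _)] _].
  - destruct (strategy c) as [r cs]. apply local_step_rule; [apply Hg|assumption].
  - split; [now apply box_step_rule|simpl; tauto].
Qed.

(** Once the rank is constant, every K step must continue the main trace. If K steps cease, the head
    of the stack is a progressing trace; if they recur for ever, the main formula is one. *)
Lemma strategy_traces (q : nat -> config) (ix : nat -> nat) :
  (forall n, good (q n)) ->
  (forall n, nth_error (snd (strategy (q n))) (ix n) = Some (q (S n))) ->
  exists (N : nat) (tau : nat -> form),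
    (forall n, N <= n -> In (tau n) (suc (label (q n))) /\
       tstep (fst (strategy (q n))) (ix n) (tau n) (tau (S n))) /\
    (forall m, exists n, m <= n /\ N <= n /\
       progress (fst (strategy (q n))) (ix n) (tau n) (tau (S n))).
Proof.
  intros Hg Hq.
  destruct (eventually_constant (fun n => rank (q n)) 0) as (N0 & _ & HN0).
  { intros n _. destruct (strategy_node _ (Hg n)) as [_ H].
    apply H. eapply nth_error_In; eauto. }
  assert (Hloc : forall n, local_step (q n) <> None ->
            exists r cs, local_step (q n) = Some (r, cs) /\
              fst (strategy (q n)) = r /\ nth_error cs (ix n) = Some (q (S n))).
  { intros n Hn. destruct (strategy_node _ (Hg n)) as [[Hs|[Hs _]] _]; [|contradiction].
    specialize (Hq n). destruct (strategy (q n)) as [r cs]. eauto. }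
  assert (Hbox : forall n, N0 <= n -> local_step (q n) = None ->
            exists a g, main (q n) = Box (Atom a) g /\ In (main (q n)) (cD (q n)) /\
              fst (strategy (q n)) = RK (Atom a) g /\ q (S n) = box_step (q n) a g).
  { intros n Hn Hs'. destruct (strategy_node _ (Hg n)) as [[Hs|(_ & a & g & E & Hin & Hr)] _];
      [congruence|].
    specialize (Hq n). rewrite E in Hq. simpl in Hq.
    assert (Eq : q (S n) = box_step (q n) a g).
    { destruct (ix n) as [|k]; simpl in Hq; [congruence|].
      now rewrite nth_error_nil in Hq. }
    specialize (HN0 n Hn). simpl in HN0. rewrite Eq in HN0.
    destruct Hr as [Hr|Hr]; [lia|]. exists a, g. rewrite E, Hr. auto. }
  destruct (classic (exists N1, N0 <= N1 /\ forall n, N1 <= n -> local_step (q n) <> None))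
    as [(N1 & HN1 & Hall)|Hinf].
  (* No more K steps: [measure] never rises, and once it is constant the stack head moves at every
     step. *)
  - assert (Hst : forall n, N1 <= n -> measure (q (S n)) < measure (q n) \/
       measure (q (S n)) = measure (q n) /\
       In (hd Bot (stack (q n))) (suc (label (q n))) /\
       tstep (fst (strategy (q n))) (ix n) (hd Bot (stack (q n))) (hd Bot (stack (q (S n)))) /\
       (size (hd Bot (stack (q (S n)))) < size (hd Bot (stack (q n))) \/
        progress (fst (strategy (q n))) (ix n) (hd Bot (stack (q n))) (hd Bot (stack (q (S n)))))).
    { intros n Hn. destruct (Hloc n (Hall n Hn)) as (r & cs & Hs & -> & Hi).
      eapply local_step_trace; [apply Hg|exact Hs|exact Hi]. }
    destruct (eventually_constant (fun n => measure (q n)) N1) as (N2 & HN2 & HC).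
    { intros n Hn. destruct (Hst n Hn) as [H|[H _]]; lia. }
    assert (Hst' : forall n, N2 <= n ->
       In (hd Bot (stack (q n))) (suc (label (q n))) /\
       tstep (fst (strategy (q n))) (ix n) (hd Bot (stack (q n))) (hd Bot (stack (q (S n)))) /\
       (size (hd Bot (stack (q (S n)))) < size (hd Bot (stack (q n))) \/
        progress (fst (strategy (q n))) (ix n) (hd Bot (stack (q n))) (hd Bot (stack (q (S n)))))).
    { intros n Hn. specialize (HC n Hn). simpl in HC.
      destruct (Hst n ltac:(lia)) as [H|[_ H]]; [lia|exact H]. }
    exists N2, (fun n => hd Bot (stack (q n))). split.
    + intros n Hn. destruct (Hst' n Hn) as (H1 & H2 & _). auto.
    + apply moving_trace_progresses with (r := fun n => fst (strategy (q n))).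
      * intros n Hn. apply Hst'; assumption.
      * intros m. exists (max m N2). repeat split; try lia. apply Hst'. lia.
  - assert (Hinf' : forall m, exists n, m <= n /\ N0 <= n /\ local_step (q n) = None).
    { intros m. apply NNPP. intros Hno. apply Hinf. exists (max m N0). split; [lia|].
      intros n Hn Hs. apply Hno. exists n. repeat split; auto; lia. }
    destruct (Hinf' N0) as (n1 & _ & Hn1 & Hs1).
    assert (Htr : forall n, N0 <= n ->
       tstep (fst (strategy (q n))) (ix n) (main (q n)) (main (q (S n))) /\
       (In (main (q n)) (suc (label (q n))) -> In (main (q (S n))) (suc (label (q (S n)))))).
    { intros n Hn. destruct (local_step (q n)) as [x|] eqn:Es.
      - destruct (Hloc n ltac:(congruence)) as (r & cs & Hs & -> & Hi).
        destruct (local_step_trace _ _ _ _ _ (proj1 (Hg n)) Hs Hi) as (H1 & H2 & _). auto.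
      - destruct (Hbox n Hn Es) as (a & g & Em & _ & -> & Eq). rewrite Eq, Em. simpl. auto. }
    (* [main] may be a default [Bot] outside the succedent until a K step resets it, so the trace
       starts at [S n1]. *)
    assert (Hmem : forall n, S n1 <= n -> In (main (q n)) (suc (label (q n)))).
    { induction 1 as [|n Hn IH].
      - destruct (Hbox n1 Hn1 Hs1) as (a & g & _ & _ & _ & ->). simpl. auto.
      - apply Htr; [lia|assumption]. }
    exists (S n1), (fun n => main (q n)). split.
    + intros n Hn. split; [auto|]. apply Htr. lia.
    + apply moving_trace_progresses with (r := fun n => fst (strategy (q n))).
      * intros n Hn. apply Htr. lia.
      (* Each of the recurring K steps strips a box off [main], so the main trace moves infinitely
         often. *)
      * intros m. destruct (Hinf' (max m (S n1))) as (n & H1 & H2 & H3).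
        exists n. repeat split; try lia. left.
        destruct (Hbox n H2 H3) as (a & g & Em & _ & _ & ->). rewrite Em. simpl. lia.
Qed.

Lemma win_provable c G D :
  good c -> seq_eq (label c) (mkSeq G D) -> cf_provable G D.
Proof.
  intros Hg. apply unfold_graph with (rl := fun c => fst (strategy c))
    (ch := fun c => snd (strategy c)) (good := good) (all := all_configs).
  - assumption.
  - intros s [Hs _]. now apply inv_finite.
  - intros s s' Hs Hin. now apply (strategy_node s Hs).
  - intros s Hs. now apply strategy_rule.
  - intros s Hs. now apply strategy_rule.
  - apply strategy_traces.
Qed.

(** * Losing configurations and their saturation *)

Variable N : nat.
Hypothesis win_N : forall c n, inv c -> win n c -> win N c.

Definition boxes_lost (c : config) : Prop :=
  forall a g, In (Box (Atom a) g) (cD c) -> ~ win N (box_step c a g).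

(** Dual, as a least fixed point, of the inner greatest one at stage [N]: the opponent drives the
    main trace to an end in finitely many rounds. *)
Inductive lost (c : config) : Prop :=
| lost_local r cs c' : local_step c = Some (r, cs) -> In c' cs -> lost c' -> lost c
| lost_box : local_step c = None -> boxes_lost c ->
    (forall a g, In (Box (Atom a) g) (cD c) -> main c = Box (Atom a) g ->
       lost (box_step c a g)) -> lost c.

(** Configurations satisfying [inv] but not [lost] form a post-fixed point of [win_step (win N)], so
    they lie in stage [S N], which [win_N] collapses into [N]. *)
Lemma not_win_lost c : inv c -> ~ win N c -> lost c.
Proof.
  intros Hinv Hw. apply NNPP. intros Hl. apply Hw, win_N with (S N); [assumption|].
  exists (fun d => inv d /\ ~ lost d). split; [|auto].
  clear c Hinv Hw Hl. intros c [Hinv Hl]. unfold win_step.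
  destruct (local_step c) as [[r cs]|] eqn:Es.
  - intros c' Hc'. split; [eapply local_step_inv; eauto|].
    intros Hl'. apply Hl. eapply lost_local; eauto.
  - apply NNPP. intros Hno. apply Hl. apply lost_box; [assumption| |].
    + intros a g Hin Hw. apply Hno. eauto.
    + intros a g Hin E. apply NNPP. intros Hl'. apply Hno.
      exists a, g. split; [assumption|]. right. auto using box_step_inv.
Qed.

Inductive realised (c : config) : form -> Prop :=
| realised_end e : In e (cD c) -> realised c e
| realised_dec f r L alts g : rdec f = Some (r, L, alts) -> incl L (cG c) ->
    In g alts -> realised c g -> realised c f.

(** Succedent parts are [realised] rather than present, since right steps discard the formulas they
    decompose. *)
Definition left_saturated (c : config) (f : form) : Prop :=
  exists L st, In (L, st) (snd (ldec f)) /\ incl L (cG c) /\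
    forall g, In g st -> realised c g.

Definition world (c : config) : Prop :=
  inv c /\ local_step c = None /\ boxes_lost c /\
  forall f, In f (cG c) -> left_saturated c f.

Definition accessible (a : A) (c d : config) : Prop :=
  forall x, In (Box (Atom a) x) (cG c) -> In x (cG d).

(* [refuted c f]: the trace of [f] through worlds from [c] ends after finitely
   many steps at a false atom. *)
Inductive refuted : config -> form -> Prop :=
| refuted_bot c : refuted c Bot
| refuted_var c x : ~ In (Var x) (cG c) -> refuted c (Var x)
| refuted_box c a g d : world d -> accessible a c d -> refuted d g ->
    refuted c (Box (Atom a) g)
| refuted_dec c f r L alts g : rdec f = Some (r, L, alts) -> incl L (cG c) ->
    In g alts -> refuted c g -> refuted c f.

(** Relates [c] to the endpoint [w] of a losing local branch from it. Formulas of [done c] are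
    exempt from the saturation clause, which lets the relation pass backwards over local steps. *)
Definition saturation (c w : config) : Prop :=
  inv w /\ local_step w = None /\ boxes_lost w /\
  incl (cG c) (cG w) /\ incl (cD c) (cD w) /\
  (forall g, In g (stack c) -> realised w g) /\
  (forall f, In f (done w) -> In f (done c) \/ left_saturated w f) /\
  refuted w (main c).

Lemma saturation_world c w : saturation c w -> done c = [] -> world w.
Proof.
  intros (H1 & H2 & H3 & _ & _ & _ & H4 & _) E. repeat split; try assumption; try apply H1.
  intros f Hf. destruct (H4 f) as [H|H]; [|now rewrite E in H|assumption].
  now apply (local_step_none _ H2).
Qed.

Lemma saturation_local c r cs c' w :
  inv c -> local_step c = Some (r, cs) -> In c' cs -> saturation c' w -> saturation c w.
Proof.
  intros Hinv Hs Hc' (H1 & H2 & H3 & HG & HD & Hst & Hdn & Hm).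
  pose proof Hinv as (IG & ID & Idn & Ist & _).
  destruct (local_step_some _ _ _ Hs) as [(-> & _)|[(g & st & E & Er)|(f & E & Hf & Hnd & El)]];
    [contradiction| |].
  - unfold right_step in Er. rewrite E in Ist. apply incl_cons_inv in Ist as [Ig Ist].
    destruct (rdec g) as [[[r' L] alts]|] eqn:Ed.
    + injection Er as <- <-. apply in_map_iff in Hc' as (g' & <- & Hg'). simpl in *.
      destruct (rdec_components _ _ _ _ Ed) as [HL _].
      assert (HLG : forall x, In x L \/ In x (cG c) -> In x (cG w)).
      { intros x Hx. apply HG, inv_union; auto. intros y Hy. now apply (cl_closed g Ig), HL. }
      unfold saturation. rewrite E. repeat split; try assumption; try apply H1.
      * intros x Hx; auto.
      * intros x [<-|Hx]; [|auto]. apply realised_dec with (1 := Ed) (g := g'); auto.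
        intros y Hy; auto.
      * unfold follow in Hm. destruct (dec (main c = g)) eqn:Em; [|assumption].
        rewrite dec_spec in Em. rewrite Em.
        apply refuted_dec with (1 := Ed) (g := g'); auto. intros y Hy; auto.
    + injection Er as <- <-. destruct Hc' as [<-|[]]. simpl in *.
      assert (HDw : forall x, In x [g] \/ In x (cD c) -> In x (cD w)).
      { intros x Hx. apply HD, in_union; auto using sublists_incl. now intros y [<-|[]]. }
      unfold saturation. rewrite E. repeat split; try assumption; try apply H1.
      * intros x Hx; auto.
      * intros x [<-|Hx]; [|auto]. apply realised_end, HDw. left; now left.
  - injection El as <- <-. apply in_map_iff in Hc' as ([L st] & <- & Hp). simpl in *.
    destruct (ldec_components _ _ _ Hp) as (HL & _ & _).
    assert (Hfc : In f cl) by now apply (sublists_incl _ _ IG).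
    assert (HLG : forall x, In x L \/ In x (cG c) -> In x (cG w)).
    { intros x Hx. apply HG, inv_union; auto. intros y Hy. now apply (cl_closed f Hfc), HL. }
    unfold saturation. rewrite E. repeat split; try assumption; try apply H1.
    + intros x Hx; auto.
    + contradiction.
    + intros x Hx. destruct (Hdn x Hx) as [Hu|Hu]; [|now right].
      apply in_union in Hu as [[<-|[]]|Hu]; [right|now left|now intros y [<-|[]]|
        now apply sublists_incl].
      (* The premise taken by this step itself witnesses that [f] is saturated. *)
      exists L, st. repeat split; [assumption| |assumption]. intros y Hy; auto.
Qed.

(** Induction on the losing derivation. At a saturated end, a main formula that is a box is refuted
    through the world obtained from its K successor; any other irreducible main formula is refuted
    on the spot. *)
Lemma lost_saturation c : lost c -> inv c -> exists w, saturation c w.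
Proof.
  induction 1 as [c r cs c' Hs Hc' _ IH|c Hs Hb _ IH]; intros Hinv.
  - destruct IH as [w Hw]; [eapply local_step_inv; eauto|].
    exists w. eapply saturation_local; eauto.
  - exists c. destruct (local_step_none _ Hs) as (E & HGd & Hdisj & _).
    pose proof Hinv as (_ & _ & _ & _ & _ & Hend & Hm).
    unfold saturation. rewrite E in *. simpl in *.
    repeat split; try assumption; try apply Hinv; try apply incl_refl; try tauto.
    destruct Hm as [Hm| ->]; [|constructor]. specialize (Hend _ Hm).
    destruct (main c) as [|x|a b|[a|p q|p q|p|b] g] eqn:Em; try discriminate.
    + constructor.
    + constructor. intros Hx. exact (Hdisj _ Hx Hm).
    + destruct (IH a g Hm eq_refl) as [w Hw]; [now apply box_step_inv|].
      apply refuted_box with w; [now apply (saturation_world _ _ Hw)| |apply Hw].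
      intros x Hx. apply Hw. now apply box_step_ant.
Qed.

(** [boxes_lost] restarts the argument: each box of [cD], main or not, has a losing K successor and
    so begins a terminating trace of its own. *)
Lemma world_refuted_end w e : world w -> In e (cD w) -> refuted w e.
Proof.
  intros (Hinv & Hs & Hb & _) He.
  destruct (local_step_none _ Hs) as (_ & _ & Hdisj & _).
  pose proof Hinv as (_ & _ & _ & _ & _ & Hend & _). specialize (Hend _ He).
  destruct e as [|x|a b|[a|p q|p q|p|b] g]; try discriminate.
  - constructor.
  - constructor. intros Hx. exact (Hdisj _ Hx He).
  - assert (Hi : inv (box_step w a g)) by now apply box_step_inv.
    destruct (lost_saturation _ (not_win_lost _ Hi (Hb a g He)) Hi) as [v Hv].
    apply refuted_box with v; [now apply (saturation_world _ _ Hv)| |apply Hv].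
    intros x Hx. apply Hv. now apply box_step_ant.
Qed.

Lemma world_refuted w f : world w -> realised w f -> refuted w f.
Proof.
  intros Hw. induction 1; [now apply world_refuted_end|]. eapply refuted_dec; eauto.
Qed.

(** * Canonical countermodel and truth lemma *)

Section Countermodel.
Variable w0 : {c | world c}.

Definition canonical : @model P A :=
  {| W := {c | world c};
     W_inhabited := inhabits w0;
     Rel := fun a u v => accessible a (proj1_sig u) (proj1_sig v);
     Val := fun u x => In (Var x) (cG (proj1_sig u)) |}.

Definition left_true (f : form) : Prop :=
  forall u : W canonical, In f (cG (proj1_sig u)) -> sat canonical u f.

(** Induction on the finite trace, not on [f], so unfolding a star on the right is harmless.
    Formulas moved left lie in [lefts f], whose truth is assumed. *)
Lemma refuted_false c f :
  refuted c f -> (forall h, In h (lefts f) -> left_true h) ->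
  forall Hc : world c, ~ sat canonical (exist _ c Hc) f.
Proof.
  induction 1 as [c|c x Hx|c a g d Hd Hacc _ IH|c f r L alts g Ed HL Hg _ IH]; intros Hh Hc.
  - simpl; tauto.
  - exact Hx.
  - intros Hs. apply (IH Hh Hd). apply (Hs (exist _ d Hd)). exact Hacc.
  - destruct (rdec_lefts _ _ _ _ _ Ed Hg) as [HLl Hgl].
    apply rdec_false with (1 := Ed) (g := g); auto.
    intros h Hh'. apply Hh; [auto|]. simpl. auto.
Qed.

Lemma world_left_saturated (u : W canonical) f :
  In f (cG (proj1_sig u)) -> left_saturated (proj1_sig u) f.
Proof. destruct u as [c Hc]. apply Hc. Qed.

Lemma realised_false (u : W canonical) f :
  (forall h, In h (lefts f) -> left_true h) -> realised (proj1_sig u) f ->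
  ~ sat canonical u f.
Proof.
  destruct u as [c Hc]. intros Hh Hr. apply refuted_false; [|assumption].
  now apply world_refuted.
Qed.

(** Structural induction suffices because falsity on the right comes from [refuted_false], which
    needs left truth only for [lefts] and [tests]; the induction carries that along. *)
Lemma truth :
  (forall f, left_true f /\ forall h, In h (lefts f) -> left_true h) /\
  (forall p, (forall h, In h (tests p) -> left_true h) /\
     forall f (u v : W canonical), In (Box p f) (cG (proj1_sig u)) ->
       rel canonical p u v -> In f (cG (proj1_sig v))).
Proof.
  apply form_prog_ind.
  - split; [|contradiction]. intros u Hu. destruct (proj2_sig u) as (_ & Hs & _).
    exfalso.
    now apply (local_step_none _ Hs).
  - intros x. split; [|contradiction]. intros u Hu. exact Hu.
  - intros a [Ha1 Ha2] b [Hb1 Hb2]. split.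
    + intros u Hu. destruct (world_left_saturated _ _ Hu) as (L & st & Hin & HL & Hst).
      intros Hsa. destruct Hin as [E|[E|[]]]; injection E as <- <-.
      * exfalso. apply (realised_false u a); auto. apply Hst. now left.
      * apply Hb1, HL. now left.
    + intros h [<-|Hh]; auto.
  - intros p [Hp1 Hp2] a [Ha1 Ha2]. split.
    + intros u Hu v Hv. apply Ha1. eapply Hp2; eauto.
    + intros h Hh. apply in_app_iff in Hh as [Hh|Hh]; auto.
  - intros a. split; [contradiction|]. intros f u v Hu Hv. apply Hv, Hu.
  - intros p [Hp1 Hp2] q [Hq1 Hq2]. split.
    + intros h Hh. apply in_app_iff in Hh as [Hh|Hh]; auto.
    + intros f u v Hu (z & Hz1 & Hz2).
      destruct (world_left_saturated _ _ Hu) as (L & st & [E|[]] & HL & _).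
      injection E as <- <-. eapply Hq2; [|exact Hz2]. eapply Hp2; [|exact Hz1].
      apply HL. now left.
  - intros p [Hp1 Hp2] q [Hq1 Hq2]. split.
    + intros h Hh. apply in_app_iff in Hh as [Hh|Hh]; auto.
    + intros f u v Hu Hv.
      destruct (world_left_saturated _ _ Hu) as (L & st & [E|[]] & HL & _).
      injection E as <- <-. destruct Hv as [Hv|Hv].
      * eapply Hp2; [|exact Hv]. apply HL. now left.
      * eapply Hq2; [|exact Hv]. apply HL. right; now left.
  - intros p [Hp1 Hp2]. split; [exact Hp1|]. intros f u v Hu Hv.
    (* Paths are peeled from the front, matching the unfolding [Box p (Box (Star p) f)] in the
       antecedent of each world. *)
    simpl in Hv. apply clos_rt_rt1n in Hv. induction Hv as [u|u z v Huz _ IH];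
      destruct (world_left_saturated _ _ Hu) as (L & st & [E|[]] & HL & _);
      injection E as <- <-.
    + apply HL. now left.
    + apply IH. eapply Hp2; [|exact Huz]. apply HL. right; now left.
  - intros a [Ha1 Ha2]. split.
    + intros h [<-|[]]; auto.
    + intros f u v Hu [<- Hsa].
      destruct (world_left_saturated _ _ Hu) as (L & st & [E|[E|[]]] & HL & Hst);
        injection E as <- <-.
      * exfalso. apply (realised_false u a); auto. apply Hst. now left.
      * apply HL. now left.
Qed.

End Countermodel.

(** With [done c] empty no antecedent formula is exempt, so the saturated endpoint is a world of the
    canonical model, and there the sequent fails. *)
Lemma not_win_invalid c : inv c -> done c = [] -> ~ win N c -> ~ valid (cG c) (stack c).
Proof.
  intros Hinv E Hw Hv. destruct (lost_saturation c (not_win_lost c Hinv Hw) Hinv) as [w Hsat].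
  pose (u := exist world w (saturation_world _ _ Hsat E)).
  destruct (Hv (canonical u) u) as (g & Hg & Hs).
  - intros f Hf. apply (proj1 (truth u)). now apply Hsat.
  - revert Hs. apply realised_false; [apply (proj1 (truth u))|]. now apply Hsat.
Qed.

End Search.

(** * Completeness over the closure of the given sequent *)

Theorem mainTheorem11 (P A : Type) (G D : list (form P A)) :
  valid G D -> cf_provable G D.
Proof.
  intros Hv.
  set (cl := flat_map fl (G ++ D)).
  assert (Hcl : forall f, In f cl -> incl (components f) cl).
  { intros f Hf g Hg. apply in_flat_map in Hf as (h & Hh & Hf). apply in_flat_map.
    exists h. split; [assumption|]. now apply (proj1 fl_closed h f). }
  assert (Hin : forall f, In f (G ++ D) -> In f cl).
  { intros f Hf. apply in_flat_map. exists f. auto using fl_self. }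
  (* Any succedent formula could be the initial main formula; [Bot] is the default when [D] is
     empty. Passing [G] through [union] makes it a sublist of [cl]. *)
  set (c := Config (union cl [] G) [] [] (hd Bot D) D).
  assert (HG : forall x, In x (cG c) <-> In x G).
  { intros x. simpl. rewrite in_union; [simpl; tauto|easy|].
    intros y Hy. apply Hin, in_app_iff; now left. }
  assert (Hinv : inv cl (length D) c).
  { repeat split; simpl; auto using union_sublists, nil_sublists; try tauto.
    - intros y Hy. apply Hin, in_app_iff; now right.
    - destruct D; simpl; auto. }
  destruct (win_bound cl (length D)) as [N HN].
  apply win_provable with (cl := cl) (depth := length D) (c := c).
  - exact Hcl.
  - split; [assumption|]. exists N. apply NNPP. intros Hw.
    apply (not_win_invalid cl (length D) Hcl N HN c Hinv eq_refl Hw).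
    intros M w Hsat. apply Hv. intros f Hf. apply Hsat, HG, Hf.
  - split; intros x; simpl; [apply HG|]. now rewrite app_nil_r.
Qed.
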